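(* For all $z\in\mathbb{C}$ and all integers $k,j\ge0$, $$zS_{kj}(z)=\mathrm{i}\frac{j}{2j+1}S_{k,j-1}(z)+\mathrm{i}\frac{j+1}{2j+1}S_{k,j+1}(z)+\frac{k}{2k+1}S_{k-1,j}(z)+\frac{k+1}{2k+1}S_{k+1,j}(z)+4\delta_{j0}\delta_{k0},$$ where terms with a negative index (which carry coefficient $0$) are taken to be $0$.
   Context: $P_k$ is the $k$-th Legendre polynomial, $\Omega=[-1,1]^2$, and $$S_{kj}(z)=\iint_\Omega\frac{P_k(s)P_j(t)}{z-(s+\mathrm{i}t)}\,ds\,dt,\qquad k,j\ge0,$$ (an absolutely convergent integral for every $z\in\mathbb{C}$). *)

(* Defs.v *)
From HB Require Import structures.
From mathcomp Require Import all_boot all_order all_algebra.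
From mathcomp Require Import all_classical all_reals all_analysis.
From mathcomp Require Import complex.
Set Implicit Arguments.
Unset Strict Implicit.
Unset Printing Implicit Defensive.
Import Order.TTheory GRing.Theory Num.Theory.
Import numFieldNormedType.Exports.
Local Open Scope classical_set_scope.
Local Open Scope ring_scope.
Local Open Scope complex_scope.

(* Rodrigues' formula *)
Definition legendre (R : realType) (k : nat) : {poly R} :=
  (2 ^+ k * k`!%:R)^-1 *: (('X^2 - 1) ^+ k)^`(k).

(* Meaningful only when both parts are integrable: otherwise Rintegral may
   return a junk value. *)
Definition Cintegral (d : measure_display) (T : measurableType d)
    (R : realType) (mu : {measure set T -> \bar R}) (D : set T)
    (f : T -> R[i]) : R[i] :=
  (\int[mu]_(x in D) complex.Re (f x)) +i* (\int[mu]_(x in D) complex.Im (f x)).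

Definition Omega (R : realType) : set (R * R) := `[-1, 1] `*` `[-1, 1].

(* At the point (s, t) = (Re z, Im z), which is a null set, the quotient is 0
   by the convention 0^-1 = 0. *)
Definition Skj (R : realType) (k j : nat) (z : R[i]) : R[i] :=
  Cintegral (@lebesgue_measure R \x @lebesgue_measure R)%E (@Omega R)
    (fun p : R * R =>
       ((legendre R k).[p.1])%:C * ((legendre R j).[p.2])%:C
         / (z - (p.1%:C + 'i%C * p.2%:C))).

(* Main.v *)
Require Import Defs.
From mathcomp Require Import all_boot all_order all_algebra.
From mathcomp Require Import all_classical all_reals all_analysis.
From mathcomp Require Import measurable_realfun ring lra.
From mathcomp Require Import complex.
Import Order.TTheory GRing.Theory Num.Theory.
Import numFieldNormedType.Exports.
Local Open Scope classical_set_scope.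
Local Open Scope ring_scope.
Local Open Scope complex_scope.

(** For polynomials p and q, let C(p, q) be the integral over the square of
    p(s) q(t) / (z - w), where w = s + i t.  Away from w = z one has
    z / (z - w) = 1 + w / (z - w), so
      z C(p, q) = C(X p, q) + i C(p, X q) + (integral of p(s) q(t)),
    which is [mul_cauchy].  For p = P_k and q = P_j, the three-term recurrence
      X P_k = k/(2k+1) P_(k-1) + (k+1)/(2k+1) P_(k+1)
    ([legendre_bonnet]) and the bilinearity of C turn the first two terms into
    the four neighbours of S_kj.  By Fubini the last term is the product of
    the integrals of P_k and P_j over [-1, 1], each of which is 2 in degree 0
    and 0 otherwise ([Cintegral_legendre]).

    The analytic content is that linearity of the integral may be used, that
    is, that 1 / (z - w) is integrable near its pole.  Its real and imaginary
    parts are bounded by 1 / m, where m is the sup-norm distance from w to z,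
    and 1 / m is dominated by 1 plus the sum over n of 2^(n+1) times the
    indicator of the square of half-side 2^-n centred at z.  The n-th square
    has area 4 / 4^n, so the integral of this series is finite
    ([integrable_inv_dist]). *)

Set Implicit Arguments.
Unset Strict Implicit.
Unset Printing Implicit Defensive.

(** * Bonnet's recurrence for the Legendre polynomials *)

(** The Leibniz rule stops after two terms, since X'' = 0. *)
Lemma derivn_Xmul (A : comNzRingType) (p : {poly A}) n :
  ('X * p)^`(n.+1) = 'X * p^`(n.+1) + p^`(n) *+ n.+1.
Proof.
elim: n => [|n IH]; first by rewrite !derivn1 derivM derivX derivn0 mul1r addrC.
rewrite derivnS IH derivD derivM derivX mul1r derivMn -!derivnS.
by rewrite [in RHS]mulrS addrA [X in X + _]addrC.
Qed.

Section Bonnet.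
Variable A : comNzRingType.
Implicit Type n : nat.

(** Legendre polynomials without their normalising factor, so that the
    recurrence has integer coefficients and holds in every commutative ring. *)
Definition rodrigues n : {poly A} := (('X^2 - 1) ^+ n)^`(n).

Lemma deriv_subX2_exp n :
  (('X^2 - 1 : {poly A}) ^+ n.+1)^`() = ('X * ('X^2 - 1) ^+ n) *+ (2 * n.+1).
Proof.
rewrite deriv_exp derivB derivXn derivC subr0 /= expr1 mulrnAl -mulrnA.
by [].
Qed.

(** With Q_n the n-th derivative of (X^2 - 1)^n and E the n-th derivative of
    (X^2 - 1)^(n+1), the Leibniz rule gives Q_(n+2) in terms of X Q_(n+1) and
    E.  The (n+1)-th derivative of X (X^2 - 1)^(n+1), taken by the Leibniz
    rule or by differentiating once and writing X^2 = (X^2 - 1) + 1, gives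
    X Q_(n+1) in terms of E and Q_n.  Eliminating E leaves the recurrence. *)
Lemma rodrigues_rec n :
  rodrigues n.+2 =
    ('X * rodrigues n.+1) *+ (2 * (2 * n.+1 + 1))
    - rodrigues n *+ (4 * n.+1 ^ 2).
Proof.
set E : {poly A} := (('X^2 - 1) ^+ n.+1)^`(n).
(* Leibniz rule applied to the derivative of (X^2 - 1)^(n+2). *)
have step1 : rodrigues n.+2 = ('X * rodrigues n.+1 + E *+ n.+1) *+ (2 * n.+2).
  by rewrite /rodrigues derivSn deriv_subX2_exp derivnMn derivn_Xmul.
(* Two values of the (n+1)-th derivative of X (X^2 - 1)^(n+1). *)
have XQ : 'X * rodrigues n.+1 = E *+ n.+2 + rodrigues n *+ (2 * n.+1).
  have : (('X : {poly A}) * ('X^2 - 1) ^+ n.+1)^`(n.+1) =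
      'X * rodrigues n.+1 + E *+ n.+1.
    by rewrite derivn_Xmul.
  rewrite derivSn derivM derivX mul1r deriv_subX2_exp mulrnAr mulrA.
  rewrite (_ : _ + _ = ('X^2 - 1) ^+ n.+1 *+ (2 * n.+1 + 1) +
      ('X^2 - 1) ^+ n *+ (2 * n.+1)); last first.
    rewrite exprS; ring.
  rewrite derivnD !derivnMn -/E -/(rodrigues n) => h.
  apply: (addIr (E *+ n.+1)); rewrite -h; ring.
rewrite step1 XQ; ring.
Qed.

End Bonnet.

Lemma legendreE (R : realType) k :
  legendre R k = (2 ^+ k * k`!%:R)^-1 *: rodrigues R k.
Proof. by []. Qed.

Lemma legendre_bonnet (R : realType) k :
  'X * legendre R k =
    (k%:R / (2 * k + 1)%:R) *: legendre R k.-1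
    + ((k + 1)%:R / (2 * k + 1)%:R) *: legendre R (k + 1).
Proof.
case: k => [|n].
  rewrite /legendre !mul0r scale0r add0r muln0 add0n fact0 !expr0 !mul1r invr1.
  rewrite /= !expr1 derivB derivXn derivC subr0 scale1r /= expr1.
  rewrite -(scaler_nat 2 'X) !scalerA.
  by rewrite (_ : 1`! = 1%N)// div1r !mulr1 mulVf ?pnatr_eq0 ?scale1r.
rewrite (addn1 n.+1) succnK !legendreE rodrigues_rec.
rewrite !factS !natrM !exprS -scalerAr !scalerBr !scalerA.
rewrite -(scaler_nat (4 * _)) -(scaler_nat (2 * _)) !scalerA addrCA -scalerBl.
have n0 : 0 <= n%:R :> R by rewrite ler0n.
have h1 : 1 + n%:R != 0 :> R by rewrite gt_eqF//; lra.
have h2 : 2 + n%:R != 0 :> R by rewrite gt_eqF//; lra.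
have h3 : 2 * (1 + n%:R) + 1 != 0 :> R by rewrite gt_eqF//; lra.
have h4 : n`!%:R != 0 :> R by rewrite pnatr_eq0 -lt0n fact_gt0.
have h5 : (2:R) ^+ n != 0 by rewrite expf_neq0.
rewrite [X in _ = _ + X *: _](_ : _ = 0) ?scale0r ?addr0; last first.
  rewrite natrM natrX; field; rewrite ?h1 ?h2 ?h3 ?h4 ?h5 //.
congr (_ *: _); rewrite natrM; field; rewrite ?h1 ?h2 ?h3 ?h4 ?h5 //.
Qed.

(** * Integrals of polynomials over the interval and the square *)

(** Differentiating p ^ n at most m times leaves a factor p ^ (n - m); hence
    (X^2 - 1)^k differentiated fewer than k times vanishes at 1 and -1.  The
    cofactor q makes the induction go through. *)
Lemma derivn_exp_factor (A : comNzRingType) (p q : {poly A}) m n : (m <= n)%N ->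
  exists r, (p ^+ n * q)^`(m) = p ^+ (n - m) * r.
Proof.
elim: m => [|m IH] mn; first by exists q; rewrite derivn0 subn0.
have [r] := IH (ltnW mn).
rewrite derivnS => ->; rewrite derivM deriv_exp.
exists ((p^`() * r) *+ (n - m) + p * r^`()).
rewrite -(subnSK mn) /= exprS; ring.
Qed.

Section PolyIntegral.
Variable R : realType.
Local Notation lam := (@lebesgue_measure R).
Local Notation mu := (lam \x lam)%E.
Local Notation RR := (measurableTypeR R * measurableTypeR R)%type.
Local Notation I := (`[-1, 1]%classic : set (measurableTypeR R)).
Implicit Types (x y r : R) (p q : {poly R}).

Lemma measurable_Omega : measurable (@Omega R : set RR).
Proof. by apply: measurableX; exact: measurable_itv. Qed.

Definition box x y r : set RR := `[x - r, x + r] `*` `[y - r, y + r].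

Lemma measurable_box x y r : measurable (box x y r : set RR).
Proof. by apply: measurableX; exact: measurable_itv. Qed.

Lemma mu_box x y r : 0 < r -> mu (box x y r) = (4 * r ^+ 2)%:E.
Proof.
move=> r0.
have lam_itv a : lam `[a - r, a + r] = (2 * r)%:E.
  rewrite lebesgue_measure_itv /= lte_fin ifT; last by lra.
  by rewrite -EFinB; congr EFin; ring.
pose I a : set R := `[a - r, a + r]%classic.
transitivity (lam (I x) * lam (I y))%E.
  by apply: product_measure1E; exact: measurable_itv.
by rewrite !lam_itv -EFinM; congr EFin; ring.
Qed.

Lemma mu_Omega_lty : (mu (@Omega R) < +oo)%E.
Proof.
have -> : @Omega R = box 0 0 1 by rewrite /box !add0r.
by rewrite mu_box// ltry.
Qed.

Lemma integral_deriv_poly (p : {poly R}) :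
  (\int[lam]_(x in I) (p^`().[x])%:E = (p.[1] - p.[-1])%:E)%E.
Proof.
rewrite EFinB; apply: (@continuous_FTC2 R (horner p^`()) (horner p)).
- lra.
- by apply: continuous_subspaceT; exact: continuous_horner.
- split.
  + by move=> x _; exact: derivable_horner.
  + by apply: cvg_at_right_filter; exact: continuous_horner.
  + by apply: cvg_at_left_filter; exact: continuous_horner.
- by move=> x _; rewrite derivE.
Qed.

(** By Rodrigues' formula P_k is, for k > 0, the derivative of a polynomial
    vanishing at both endpoints. *)
Lemma integral_legendre k :
  (\int[lam]_(x in I) (legendre R k).[x]%:E = (2 * (k == 0%N)%:R)%:E)%E.
Proof.
case: k => [|k].
  have -> : legendre R 0 = ('X)^`().
    rewrite legendreE derivX /rodrigues expr0 derivn0 expr0 fact0 mulr1.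
    by rewrite invr1 scale1r.
  rewrite integral_deriv_poly !hornerX; congr EFin; rewrite eqxx mulr1; ring.
pose p : {poly R} :=
  (2 ^+ k.+1 * k.+1`!%:R)^-1 *: (('X^2 - 1) ^+ k.+1)^`(k).
have -> : legendre R k.+1 = p^`() by rewrite legendreE derivZ.
have p0 x : x ^+ 2 = 1 -> p.[x] = 0.
  have [r er] := derivn_exp_factor ('X^2 - 1 : {poly R}) 1 (leqnSn k).
  rewrite /p -[('X^2 - 1) ^+ k.+1]mulr1 er subSnn expr1 hornerZ hornerM.
  by rewrite hornerD hornerXn hornerN hornerC => ->; rewrite subrr mul0r mulr0.
by rewrite integral_deriv_poly !p0 ?sqrrN ?expr1n// subrr mulr0.
Qed.

Lemma measurable_horner p : measurable_fun setT (horner p).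
Proof. by apply: continuous_measurable_fun; exact: continuous_horner. Qed.

Lemma integrable_horner p : lam.-integrable I (EFin \o horner p).
Proof.
apply: continuous_compact_integrable; first exact: segment_compact.
by apply: continuous_subspaceT; exact: continuous_horner.
Qed.

Lemma measurable_horner2 p q :
  measurable_fun setT (fun t : RR => p.[t.1] * q.[t.2]).
Proof.
apply: measurable_funM.
  exact: (measurableT_comp (measurable_horner p) measurable_fst).
exact: (measurableT_comp (measurable_horner q) measurable_snd).
Qed.

Lemma bounded_horner2 p q :
  [bounded p.[t.1] * q.[t.2] | t in @Omega R].
Proof.
have [M pM] := poly_itv_bound p (-1) 1.
have [N qN] := poly_itv_bound q (-1) 1.
exists (`|M * N|); split => // r Mr [s t] [/=].
rewrite !in_itv /= => /pM ps /qN qt.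
rewrite normrM (le_trans _ (ltW Mr))// (le_trans _ (ler_norm _))//.
by rewrite ler_pM.
Qed.

Lemma integrable_horner2 p q :
  mu.-integrable (@Omega R) (fun t : RR => (p.[t.1] * q.[t.2])%:E).
Proof.
have mO := measurable_Omega.
have : mu.-integrable (@Omega R) (cst 1%E).
  apply/integrableP; split => //.
  rewrite (_ : (fun _ => _) = cst 1%E); last first.
    by apply/funext => x; rewrite abse1.
  rewrite integral_cst// mul1e.
  exact: mu_Omega_lty.
have mpq := measurable_funTS (measurable_horner2 p q).
move=> /(integrableMr mO (mpq _) (bounded_horner2 p q)).
by apply: eq_integrable => // x _; rewrite /= mule1.
Qed.

(** Fubini's theorem concerns integrals over the whole plane; extending the
    integrand by 0 makes each inner integral p(s) times the integral of q if s
    lies in [-1, 1], and 0 otherwise. *)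
Lemma integral_horner2 p q :
  (\int[mu]_(t in @Omega R) (p.[t.1] * q.[t.2])%:E =
   \int[lam]_(x in I) (p.[x])%:E * \int[lam]_(x in I) (q.[x])%:E)%E.
Proof.
have mO := measurable_Omega.
have mI : measurable I by exact: measurable_itv.
pose f (t : RR) : \bar R := (p.[t.1] * q.[t.2])%:E.
have fi : mu.-integrable setT (f \_ (@Omega R)).
  by rewrite -integrable_mkcond//; exact: integrable_horner2.
rewrite integral_mkcond -(integral12_prod_meas1 fi).
have qfin : (\int[lam]_(x in I) (q.[x])%:E \is a fin_num)%E.
  by apply: integrable_fin_num => //; exact: integrable_horner.
rewrite [X in (X * _)%E]integral_mkcond -(fineK qfin) muleC.
rewrite -integralZl//; last first.
  by rewrite -integrable_mkcond//; exact: integrable_horner.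
apply: eq_integral => s _; rewrite /fubini_F fineK//.
have [sI|sI] := boolP (s \in I); rewrite patchE.
  rewrite sI muleC -integralZl//; last exact: integrable_horner.
  rewrite [RHS]integral_mkcond; apply: eq_integral => t _.
  rewrite !patchE (_ : ((s, t) \in @Omega R) = (t \in I)).
    by case: ifP => // _; rewrite /f EFinM.
  move: sI; rewrite inE => sI.
  by apply/idP/idP; rewrite !inE; [case|split].
rewrite (negbTE sI) mule0; apply: integral0_eq => t _.
rewrite patchE ifF//; apply/negbTE; apply: contraNN sI.
by rewrite !inE => -[].
Qed.

(** * Integrability of the Cauchy kernel *)

(** In the application r is the sup-norm distance to the pole: the point lies
    in the square of half-side 2^-n, whose weight 2^(n+1) dominates 1 / r. *)
Lemma dyadic_scale r : 0 < r <= 1 ->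
  exists n : nat, r <= (2 ^+ n)^-1 /\ r^-1 <= 2 ^+ n.+1.
Proof.
move=> /andP[r0 r1].
have s1 : 1 <= r^-1 by rewrite invf_ge1.
have [n /andP[n1 n2]] := unstable.leq_ltn_expn (Num.trunc r^-1).-1.
have t0 : (0 < Num.trunc r^-1)%N by rewrite Num.Theory.truncn_gt0.
move: n1 n2; rewrite prednK// => n1 n2; exists n; split.
  rewrite -[leLHS]invrK lef_pV2 ?posrE ?invr_gt0 ?exprn_gt0//.
  rewrite -natrX (le_trans (_ : _ <= (Num.trunc r^-1)%:R)) ?ler_nat//.
  by rewrite truncn_le (le_trans ler01).
rewrite -natrX ltW// (lt_le_trans (truncnS_gt _))// ler_nat//.
Qed.

(** The plane has dimension 2, so a singularity of order 1 is integrable: the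
    dyadic squares b n around (x, y) have area 4 / 4^n and carry weight
    2^(n+1). *)
Lemma integrable_inv_dist (x y : R) (f : RR -> R) :
  measurable_fun setT f ->
  (forall t, `|f t| <= (Num.max `|x - t.1| `|y - t.2|)^-1) ->
  mu.-integrable (@Omega R) (EFin \o f).
Proof.
move=> mf fle.
have mO := measurable_Omega.
pose b n := box x y (2 ^+ n)^-1.
pose g n (t : RR) : \bar R := ((2 ^+ n.+1)%:E * (\1_(b n) t)%:E)%E.
have g0 n t : (0 <= g n t)%E by rewrite mule_ge0 // lee_fin ?exprn_ge0.
have mg n : measurable_fun (@Omega R : set RR) (g n).
  apply/measurable_EFinP.
  apply: measurable_funM => //.
  by apply: measurable_indic; exact: measurable_box.
pose S (t : RR) : \bar R := (\sum_(n <oo) g n t)%E.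
have S0 t : (0 <= S t)%E by exact: nneseries_ge0.
have mS : measurable_fun (@Omega R : set RR) S by exact: ge0_emeasurable_sum.
pose G (t : RR) : \bar R := (cst 1 t + S t)%E.
have bound t : (`|f t|%:E <= G t)%E.
  rewrite /G; set m := Num.max `|x - t.1| `|y - t.2|.
  have m0 : 0 <= m by rewrite le_max normr_ge0.
  apply: (@le_trans _ _ (m^-1)%:E); first by rewrite lee_fin fle.
  have [m1|m1] := leP 1 m.
    by rewrite -[leLHS]adde0 leeD// lee_fin invf_le1// (lt_le_trans ltr01).
  (* At the pole the bound m^-1 is 0, by the convention 0^-1 = 0. *)
  have [->|mn0] := eqVneq m 0; first by rewrite invr0 adde_ge0.
  have [n [n1 n2]] : exists n : nat, m <= (2 ^+ n)^-1 /\ m^-1 <= 2 ^+ n.+1.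
    by apply: dyadic_scale; rewrite lt0r mn0 m0 ltW.
  rewrite -[leLHS]add0e leeD//.
  apply: le_trans (nneseries_lim_ge n.+1 _) => //.
  rewrite big_nat_recr//= -[leLHS]add0e leeD ?sume_ge0//.
  have bnp : b n t.
    move: n1; rewrite ge_max => /andP[]; rewrite !ler_norml => *.
    by split; rewrite /= in_itv /=; lra.
  by rewrite /g indicE mem_set// mule1 lee_fin.
apply/integrableP; split.
  apply/measurable_EFinP.
  exact: measurable_funS mf.
have intS : (\int[mu]_(t in @Omega R) G t =
    \int[mu]_(t in @Omega R) cst 1 t + \int[mu]_(t in @Omega R) S t)%E.
  exact: ge0_integralD.
have : (\int[mu]_(t in @Omega R) `|(f t)%:E| <=
        \int[mu]_(t in @Omega R) G t)%E.
  apply: ge0_le_integral => //.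
  - apply: measurableT_comp => //; apply/measurable_EFinP.
    exact: measurable_funS mf.
  - exact: emeasurable_funD.
  - by move=> t _; exact: bound.
rewrite intS => /le_lt_trans; apply.
rewrite integral_cst// mul1e lte_add_pinfty//.
  exact: mu_Omega_lty.
rewrite integral_nneseries//.
(* The n-th term integrates to at most 2^(n+1) * 4 / 4^n = 16 / 2^(n+1). *)
apply: (@le_lt_trans _ _ (\sum_(n <oo) (16 / (2 ^ n.+1)%:R)%:E)%E).
  apply: lee_nneseries => [n _ _|n _]; first exact: integral_ge0.
  rewrite ge0_integralZl//; last first.
    apply/measurable_EFinP; apply: measurable_indic.
    exact: measurable_box.
  rewrite integral_indic//; last exact: measurable_box.
  apply: (@le_trans _ _ ((2 ^+ n.+1)%:E * mu (b n))%E).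
    apply: lee_wpmul2l; first by rewrite lee_fin exprn_ge0.
    apply: le_measure; rewrite ?inE//; [|exact: measurable_box].
    by apply: measurableI => //; exact: measurable_box.
  rewrite mu_box ?invr_gt0 ?exprn_gt0// -EFinM lee_fin natrX !exprS.
  have := exprn_gt0 n (ltr0n R 2). set e := 2 ^+ n => e0.
  by rewrite le_eqVlt; apply/orP; left; apply/eqP; field; rewrite gt_eqF.
by apply: (le_lt_trans (epsilon_trick0 _ _)); rewrite ?ltry.
Qed.

End PolyIntegral.

(** The denominator is at least the square of the maximum on the right, and
    the numerator at most that maximum; if a = b = 0 both sides are 0. *)
Lemma le_norm_cauchy_kernel (R : realFieldType) (a b : R) :
  `|a / (a ^+ 2 + b ^+ 2)| <= (Num.max `|a| `|b|)^-1.
Proof.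
set m := Num.max _ _.
have m0 : 0 <= m by rewrite le_max normr_ge0.
have am : `|a| <= m by rewrite le_max lexx.
have [e|s0] := eqVneq (a ^+ 2 + b ^+ 2) 0.
  by rewrite e invr0 mulr0 normr0 invr_ge0.
have sp : 0 < a ^+ 2 + b ^+ 2 by rewrite lt_def s0 addr_ge0 ?sqr_ge0.
have ms : m ^+ 2 <= a ^+ 2 + b ^+ 2.
  rewrite /m; case: (leP `|a| `|b|) => _; rewrite real_normK ?num_real//.
    by rewrite lerDr sqr_ge0.
  by rewrite lerDl sqr_ge0.
have mp : 0 < m.
  rewrite lt_def m0 andbT; apply: contraNneq s0 => me.
  move: am; rewrite me normr_le0 => /eqP ->.
  have : `|b| <= m by rewrite le_max lexx orbT.
  by rewrite me normr_le0 => /eqP ->; rewrite expr0n addr0.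
rewrite normrM normfV (ger0_norm (ltW sp)) ler_pdivrMr// ler_pdivlMl//.
apply: le_trans ms; rewrite expr2 ler_wpM2l//.
Qed.

(** * Linearity of the complex integral *)

Section ComplexParts.
Variable R : realType.
Implicit Types u v : R[i].

Lemma ReD u v : complex.Re (u + v) = complex.Re u + complex.Re v.
Proof. by case: u v => [a b] [e f]. Qed.

Lemma ImD u v : complex.Im (u + v) = complex.Im u + complex.Im v.
Proof. by case: u v => [a b] [e f]. Qed.

Lemma ReM u v : complex.Re (u * v) =
  complex.Re u * complex.Re v - complex.Im u * complex.Im v.
Proof. by case: u v => [a b] [e f]. Qed.

Lemma ImM u v : complex.Im (u * v) =
  complex.Re u * complex.Im v + complex.Im u * complex.Re v.
Proof. by case: u v => [a b] [e f]. Qed.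

Lemma ReV u : complex.Re u^-1 =
  complex.Re u / (complex.Re u ^+ 2 + complex.Im u ^+ 2).
Proof. by case: u. Qed.

Lemma ImV u : complex.Im u^-1 =
  - (complex.Im u / (complex.Re u ^+ 2 + complex.Im u ^+ 2)).
Proof. by case: u. Qed.

End ComplexParts.

Section ComplexIntegral.
Context d (T : measurableType d) (R : realType).
Variables (mu : {measure set T -> \bar R}) (D : set T).
Hypothesis mD : measurable D.
Implicit Types (f g : T -> R[i]) (c : R[i]).

Definition Cintegrable f :=
  mu.-integrable D (EFin \o (fun x => complex.Re (f x))) /\
  mu.-integrable D (EFin \o (fun x => complex.Im (f x))).

Lemma CintegrableD f g : Cintegrable f -> Cintegrable g ->
  Cintegrable (fun x => f x + g x).
Proof.
move=> [fr fi] [gr gi]; split.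
  rewrite (_ : _ \o _ = (EFin \o (fun x => complex.Re (f x))) \+
    (EFin \o (fun x => complex.Re (g x))))%E; first exact: integrableD.
  by apply/funext => x /=; rewrite ReD.
rewrite (_ : _ \o _ = (EFin \o (fun x => complex.Im (f x))) \+
  (EFin \o (fun x => complex.Im (g x))))%E; first exact: integrableD.
by apply/funext => x /=; rewrite ImD.
Qed.

Let integrableZ (a : R) (h : T -> R) : mu.-integrable D (EFin \o h) ->
  mu.-integrable D (EFin \o (fun x => a * h x)).
Proof. exact: integrableZl. Qed.

Lemma CintegrableZ c f : Cintegrable f -> Cintegrable (fun x => c * f x).
Proof.
move=> [fr fi]; split.
  rewrite (_ : _ \o _ =
    (EFin \o (fun x => (complex.Re c * complex.Re (f x))%R)) \-
    (EFin \o (fun x => (complex.Im c * complex.Im (f x))%R)))%E.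
    by apply: integrableB => //; exact: integrableZ.
  by apply/funext => x /=; rewrite ReM.
rewrite (_ : _ \o _ =
  (EFin \o (fun x => (complex.Re c * complex.Im (f x))%R)) \+
  (EFin \o (fun x => (complex.Im c * complex.Re (f x))%R)))%E.
  by apply: integrableD => //; exact: integrableZ.
by apply/funext => x /=; rewrite ImM.
Qed.

Lemma CintegralD f g : Cintegrable f -> Cintegrable g ->
  Cintegral mu D (fun x => f x + g x) = Cintegral mu D f + Cintegral mu D g.
Proof.
move=> [fr fi] [gr gi]; rewrite /Cintegral.
under eq_Rintegral do rewrite ReD.
under [X in _ +i* X = _]eq_Rintegral do rewrite ImD.
by rewrite !RintegralD.
Qed.

Lemma CintegralZ c f : Cintegrable f ->
  Cintegral mu D (fun x => c * f x) = c * Cintegral mu D f.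
Proof.
move=> [fr fi]; rewrite /Cintegral.
under eq_Rintegral do rewrite ReM.
under [X in _ +i* X = _]eq_Rintegral do rewrite ImM.
rewrite RintegralB ?RintegralD ?RintegralZl//; try exact: integrableZ.
by case: c => a b.
Qed.

Lemma eq_Cintegral_off_null (N : set T) f g : measurable N -> mu N = 0%E ->
  Cintegrable f -> Cintegrable g ->
  (forall x, ~ N x -> f x = g x) -> Cintegral mu D f = Cintegral mu D g.
Proof.
move=> mN N0 [fr fi] [gr gi] fg.
rewrite /Cintegral /Rintegral; congr (fine _ +i* fine _);
  (apply: ae_eq_integral => //;
    [exact: (measurable_int mu)|exact: (measurable_int mu)|]);
  exists N; split => // x /= fgx; apply: contrapT => Nx; apply: fgx => _;
  by rewrite fg.
Qed.

End ComplexIntegral.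

(** * The Cauchy transform of a product of polynomials *)

Section CauchyTransform.
Variables (R : realType) (z : R[i]).
Local Notation lam := (@lebesgue_measure R).
Local Notation mu := (lam \x lam)%E.
Local Notation RR := (measurableTypeR R * measurableTypeR R)%type.
Implicit Types p q : {poly R}.

Let mO := @measurable_Omega R.

Definition cauchy_integrand p q (t : RR) : R[i] :=
  (p.[t.1])%:C * (q.[t.2])%:C / (z - (t.1%:C + 'i%C * t.2%:C)).

Definition cauchy p q : R[i] := Cintegral mu (@Omega R) (cauchy_integrand p q).

(** The maximum in the hypothesis is symmetric in a and b, so this covers both
    the real part of the kernel and, with a and b exchanged, the imaginary
    part. *)
Lemma integrable_kernel (a b : RR -> R) :
  measurable_fun setT a -> measurable_fun setT b ->
  (forall t, Num.max `|a t| `|b t| =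
    Num.max `|complex.Re z - t.1| `|complex.Im z - t.2|) ->
  mu.-integrable (@Omega R) (EFin \o (fun t => a t / (a t ^+ 2 + b t ^+ 2))).
Proof.
move=> ma mb ab.
apply: (@integrable_inv_dist R (complex.Re z) (complex.Im z)); last first.
  by move=> t; rewrite -ab; exact: le_norm_cauchy_kernel.
apply: measurable_funM => //.
rewrite (_ : (fun _ => _) =
    (@powR R ^~ (-1)) \o (fun t => a t ^+ 2 + b t ^+ 2)).
  apply: measurableT_comp; first exact: measurable_powR.
  by apply: measurable_funD; exact: measurable_funX.
by apply/funext => t /=; rewrite powR_inv1// addr_ge0// sqr_ge0.
Qed.

Lemma cauchy_integrandE p q t :
  let a := complex.Re z - t.1 in let b := complex.Im z - t.2 in
  cauchy_integrand p q t =
    (p.[t.1] * q.[t.2] * (a / (a ^+ 2 + b ^+ 2))) +i*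
    (- (p.[t.1] * q.[t.2]) * (b / (a ^+ 2 + b ^+ 2))).
Proof.
move=> a b; rewrite /cauchy_integrand.
have -> : z - (t.1%:C + 'i%C * t.2%:C) = a +i* b.
  rewrite /a /b; case: z => x y; apply/eqP; rewrite eq_complex /=.
  by apply/andP; split; apply/eqP; ring.
apply/eqP; rewrite eq_complex /= ?ReM ?ImM ?ReV ?ImV /=.
by apply/andP; split; apply/eqP; ring.
Qed.

Lemma cauchy_integrable p q : Cintegrable mu (@Omega R) (cauchy_integrand p q).
Proof.
pose a (t : RR) := complex.Re z - t.1; pose b (t : RR) := complex.Im z - t.2.
have ma : measurable_fun setT a.
  by apply: measurable_funB => //; exact: measurable_fst.
have mb : measurable_fun setT b.
  by apply: measurable_funB => //; exact: measurable_snd.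
have ia := integrable_kernel ma mb (fun=> erefl).
have ib := integrable_kernel mb ma (fun t => maxC _ _).
have mpq p' : measurable_fun (@Omega R : set RR) (fun t => p'.[t.1] * q.[t.2]).
  by apply: measurable_funTS; exact: measurable_horner2.
split.
  move: (integrableMr mO (mpq p) (bounded_horner2 p q) ia).
  apply: eq_integrable => // t _; rewrite /= -EFinM; congr EFin.
  by rewrite cauchy_integrandE.
move: (integrableMr mO (mpq (- p)) (bounded_horner2 (- p) q) ib).
apply: eq_integrable => // t _; rewrite /= -EFinM; congr EFin.
by rewrite cauchy_integrandE hornerN mulNr [b t ^+ 2 + _]addrC.
Qed.

Lemma cauchy_linearl a b p p' q :
  cauchy (a *: p + b *: p') q = a%:C * cauchy p q + b%:C * cauchy p' q.
Proof.
rewrite /cauchy -!CintegralZ//; try exact: cauchy_integrable.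
rewrite -CintegralD//;
  try (apply: CintegrableZ => //; exact: cauchy_integrable).
congr Cintegral; apply/funext => t; rewrite /cauchy_integrand.
rewrite hornerD !hornerZ rmorphD !rmorphM; ring.
Qed.

Lemma cauchy_linearr a b p q q' :
  cauchy p (a *: q + b *: q') = a%:C * cauchy p q + b%:C * cauchy p q'.
Proof.
rewrite /cauchy -!CintegralZ//; try exact: cauchy_integrable.
rewrite -CintegralD//;
  try (apply: CintegrableZ => //; exact: cauchy_integrable).
congr Cintegral; apply/funext => t; rewrite /cauchy_integrand.
rewrite hornerD !hornerZ rmorphD !rmorphM; ring.
Qed.

(** z / (z - w) = 1 + w / (z - w) fails only at w = z, where the integrand of
    the transform is 0; that point is a null set. *)
Lemma mul_cauchy p q :
  z * cauchy p q = cauchy ('X * p) q + 'i%C * cauchy p ('X * q)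
    + Cintegral mu (@Omega R) (fun t : RR => (p.[t.1] * q.[t.2])%:C).
Proof.
have ipq : Cintegrable mu (@Omega R) (fun t : RR => (p.[t.1] * q.[t.2])%:C).
  split; first exact: integrable_horner2.
  rewrite (_ : _ \o _ = cst 0%E) //; exact: integrable0.
have iC p' q' := cauchy_integrable p' q'.
have iX : Cintegrable mu (@Omega R) (fun t =>
    cauchy_integrand ('X * p) q t + 'i%C * cauchy_integrand p ('X * q) t).
  by apply: CintegrableD => //; exact: CintegrableZ.
rewrite /cauchy -!CintegralZ// -CintegralD//; last exact: CintegrableZ.
rewrite -CintegralD//.
pose N : set RR := [set complex.Re z] `*` [set complex.Im z].
apply: (eq_Cintegral_off_null mO (N := N)).
- by apply: measurableX; exact: measurable_set1.
- transitivity (lam [set complex.Re z] * lam [set complex.Im z])%E.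
    by apply: product_measure1E; exact: measurable_set1.
  by rewrite !lebesgue_measure_set1 mul0e.
- exact: CintegrableZ.
- exact: CintegrableD.
move=> t Nt; rewrite /cauchy_integrand.
have zt : z - (t.1%:C + 'i%C * t.2%:C) != 0.
  apply/eqP => zt0; apply: Nt; move: zt0; rewrite /N; case: z => x y.
  move=> /eqP; rewrite eq_complex /= => /andP[/eqP h1 /eqP h2].
  by split => /=; lra.
rewrite !hornerM !hornerX !rmorphM.
by field.
Qed.

End CauchyTransform.

Lemma Cintegral_legendre (R : realType) k j :
  Cintegral (@lebesgue_measure R \x @lebesgue_measure R)%E (@Omega R)
    (fun t => ((legendre R k).[t.1] * (legendre R j).[t.2])%:C) =
  4 * (j == 0%N)%:R * (k == 0%N)%:R.
Proof.
rewrite /Cintegral /= Rintegral_cst ?mul0r; last exact: measurable_Omega.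
rewrite /Rintegral integral_horner2 !integral_legendre -EFinM /= complexr0.
rewrite -(rmorph_nat (real_complex R) 4).
rewrite -2!(rmorph_nat (real_complex R) (_ == _)) -!rmorphM.
by congr (_%:C); ring.
Qed.

Unset Implicit Arguments.
Set Strict Implicit.

(* When k = 0 (resp. j = 0), the index k.-1 (resp. j.-1) is a dummy 0: the
   term vanishes through its coefficient. *)
Theorem proposition3p1 (R : realType) (z : R[i]) (k j : nat) :
  z * Skj k j z =
      'i%C * (j%:R / (2 * j + 1)%:R) * Skj k j.-1 z
    + 'i%C * ((j + 1)%:R / (2 * j + 1)%:R) * Skj k (j + 1) z
    + k%:R / (2 * k + 1)%:R * Skj k.-1 j z
    + (k + 1)%:R / (2 * k + 1)%:R * Skj (k + 1) j z
    + 4 * (j == 0%N)%:R * (k == 0%N)%:R.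
Proof.
have SE k' j' : Skj k' j' z = cauchy z (legendre R k') (legendre R j') by [].
rewrite !SE mul_cauchy !legendre_bonnet cauchy_linearl cauchy_linearr.
rewrite Cintegral_legendre !rmorphM !fmorphV !rmorph_nat; ring.
Qed.
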